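(* Let $K$ be an infinite field, $n\ge 2$, let $\ell_1,\dots,\ell_n$ be positive integers, $P=K[y_1,\dots,y_n]$, $S=K[x_1,\dots,x_n]$, and let $\Phi:P\to S$ be the $K$-algebra monomorphism with $\Phi(y_i)=x_i^{\ell_i}$; denote also by $\Phi$ its coordinatewise extension $P^t\to S^t$. Let $\overline J\subset P$ be a monomial ideal and let $J=\Phi(\overline J)S$ be the corresponding weighted ideal. Then, for every $h\in\{0,\dots,n\}$, the map $\Phi$ provides a bijection between a set of minimal generators of the $h$-th module of syzygies of $\overline J$ and a set of minimal generators of the $h$-th module of syzygies of $J$. In particular, the total Betti numbers of $\overline J$ coincide with the total Betti numbers of $J$.
   Context: A monomial ideal $J\subset S$ is weighted by $(\ell_1,\dots,\ell_n)$ if its minimal monomial generating set $B_J$ consists of terms of the form $x_1^{\alpha_1\ell_1}\cdots x_n^{\alpha_n\ell_n}$; then there is a monomial ideal $\overline J\subset P$ with $\Phi(B_{\overline J})=B_J$. The $0$-th syzygy module of an ideal is the ideal itself; the $h$-th syzygy module is the kernel of the map from a free module onto the $(h-1)$-th syzygy module sending the canonical basis to a chosen set of minimal generators. The syzygy modules of $\overline J$ and $J$ are formed with respect to sets of minimal generators at the previous steps that correspond to each other under $\Phi$ (for $h=0$: $B_{\overline J}$ and $B_J$). The $h$-th total Betti number is the number of minimal generators of the $h$-th syzygy module, i.e. the rank of the $h$-th module in the minimal free resolution of the ideal. *)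

(* Defs.v *)
From HB Require Import structures.
From mathcomp Require Import all_boot all_order all_algebra.
From mathcomp Require Export mpoly.
From Stdlib Require Import ClassicalEpsilon.

Set Implicit Arguments.
Unset Strict Implicit.
Unset Printing Implicit Defensive.

Import GRing.Theory.
Local Open Scope ring_scope.

Definition bijects (T U : Type) (f : T -> U) (A : T -> Prop) (B : U -> Prop) :
    Prop :=
  [/\ forall x, A x -> B (f x),
      forall x y, A x -> A y -> f x = f y -> x = y
    & forall y, B y -> exists2 x, A x & f x = y].

Section Ideals.
Variables (R : comNzRingType).

Definition ideal_gen (A : R -> Prop) (p : R) : Prop :=
  exists (k : nat) (c g : 'I_k -> R),
    (forall i, A (g i)) /\ p = \sum_(i < k) c i * g i.

End Ideals.

Section Syzygies.
Variables (n : nat) (K : fieldType).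
Local Notation P := {mpoly K[n]}.

Definition monomial_ideal (I : P -> Prop) : Prop :=
  exists A : 'X_{1..n} -> Prop,
    forall p, I p <-> ideal_gen (fun q => exists2 m, A m & q = 'X_[m]) p.

(* A family of s vectors of P^t is the list of rows of an s x t matrix. *)
Definition row_set (s t : nat) (G : 'M[P]_(s, t)) (v : 'rV[P]_t) : Prop :=
  exists i, v = row i G.

Definition generates (s t : nat) (M : 'rV[P]_t -> Prop) (G : 'M[P]_(s, t)) :
    Prop :=
  forall v, M v <-> exists c : 'rV[P]_s, v = c *m G.

(* P^t carries the fine (Z^n-)grading in which the j-th basis vector has degree
   a j; v is homogeneous of degree d for it. *)
Definition mhomog (t : nat) (a : 'I_t -> 'X_{1..n}) (v : 'rV[P]_t)
    (d : 'X_{1..n}) : Prop :=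
  forall j m, m \in msupp (v ord0 j) -> (m + a j)%MM = d.

(* Homogeneity is required because irredundant families of inhomogeneous
   generators of a graded module need not have the same cardinality: X^2 and
   X - X^2 form an irredundant generating set of the ideal (X). *)
Definition min_gens (s t : nat) (M : 'rV[P]_t -> Prop) (a : 'I_t -> 'X_{1..n})
    (G : 'M[P]_(s, t)) (b : 'I_s -> 'X_{1..n}) : Prop :=
  [/\ generates M G,
      forall i, ~ generates M (row' i G)
    & forall i, mhomog a (row i G) (b i)].

(* Successive choices of generators: the rows of [gens D k] are the generators
   chosen for the k-th syzygy module, a submodule of P^(rk D k), and
   [degs D k.+1] are their degrees, hence the degrees of the basis vectors of
   P^(rk D k.+1). The ideal itself lies in P^1, with basis vector of degree
   [degs D 0]. *)
Definition frank (r : nat -> nat) (k : nat) : nat :=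
  if k is k'.+1 then r k' else 1%N.

Record choices := Choices {
  num_gens : nat -> nat;
  gens : forall k, 'M[P]_(frank num_gens k.+1, frank num_gens k);
  degs : forall k, 'I_(frank num_gens k) -> 'X_{1..n}
}.

Definition rk (D : choices) : nat -> nat := frank (num_gens D).

Definition syz (I : P -> Prop) (D : choices) (k : nat) :
    'rV[P]_(rk D k) -> Prop :=
  match k return 'rV[P]_(rk D k) -> Prop with
  | 0 => fun v : 'rV[P]_1 => I (v ord0 ord0)
  | k'.+1 => fun v => v *m gens D k' = 0
  end.
Arguments syz : clear implicits.

(* For k = 0 the minimal generators must be monomials with coefficient 1, so
   they form the minimal monomial generating set of I. *)
Definition syz_min_gens (I : P -> Prop) (D : choices) (k s : nat)
    (G : 'M[P]_(s, rk D k)) (b : 'I_s -> 'X_{1..n}) : Prop :=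
  min_gens (syz I D k) (@degs D k) G b /\
  (k = 0%N -> forall i j, exists m : 'X_{1..n}, G i j = 'X_[m]).

(* The choices recorded in D are legitimate for the syzygy modules of I of
   index < h; the remaining ones are irrelevant. *)
Definition valid_choices (I : P -> Prop) (D : choices) (h : nat) : Prop :=
  (forall j, @degs D 0 j = 0%MM) /\
  (forall k, (k < h)%N -> syz_min_gens I (gens D k) (@degs D k.+1)).

Definition is_total_betti (I : P -> Prop) (h b : nat) : Prop :=
  exists2 D, valid_choices I D h.+1 & b = num_gens D h.

(* By the uniqueness of minimal graded free resolutions exactly one b
   satisfies [is_total_betti I h b] when I is a monomial ideal. *)
Definition total_betti (I : P -> Prop) (h : nat) : nat :=
  epsilon (inhabits 0%N) (is_total_betti I h).

End Syzygies.

Section Phi.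
Variables (n : nat) (K : fieldType) (l : 'I_n -> nat).
Local Notation P := {mpoly K[n]}.

Definition Phi (p : P) : P := comp_mpoly [tuple 'X_i ^+ l i | i < n] p.

Definition Phi_mx (s t : nat) (G : 'M[P]_(s, t)) : 'M[P]_(s, t) :=
  map_mx Phi G.

Definition Phi_ideal (I : P -> Prop) : P -> Prop :=
  ideal_gen (fun q => exists2 p, I p & q = Phi p).

Definition Phi_deg (m : 'X_{1..n}) : 'X_{1..n} := [multinom (l i * m i)%N | i < n].

Definition Phi_choices (D : choices n K) : choices n K :=
  @Choices n K (num_gens D) (fun k => Phi_mx (gens D k))
    (fun k i => Phi_deg (@degs _ _ D k i)).

End Phi.

(* Main.v *)
Require Import Defs.
From HB Require Import structures.
From mathcomp Require Import all_boot all_order all_algebra.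
From mathcomp.multinomials Require Import ssrcomplements.
From Stdlib Require Import ClassicalEpsilon FunctionalExtensionality.
From Stdlib Require Import PropExtensionality.

(** Write [l] for the weights, [P] for the source of [Phi] and [S] for its
    target. The reason behind the theorem is that [S] is a free module over the
    subring [Phi(P)], with basis the monomials [x^r] such that [r i < l i]: a
    monomial [x^m] is uniquely [x^r Phi(y^q)], where [q] and [r] are the
    coordinatewise quotient and remainder of [m] by [l]. Let [ppart r] be the
    coordinate of index [r], a [P]-linear map from [S] to [P]; then [ppart 0] is
    a retraction of [Phi]. A matrix with entries in [Phi(P)] acts separately on
    each coordinate, so the kernel of [Phi A] consists of the rows whose
    coordinates all lie in the kernel of [A] ([kernel_extends]), and likewise
    for a monomial ideal ([ideal_extends]). Hence each syzygy module of [J] is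
    the extension along [Phi] of the corresponding syzygy module of [Jbar].

    If [N] is the extension of [M] in this sense, a family [G] generates [M]
    exactly when [Phi G] generates [N] ([generates_extends], which applies
    [ppart] to the coefficients of a linear combination). Applied to [G] and to
    [G] without one of its rows, this shows that minimal generators correspond
    to minimal generators ([min_gens_extends]). The first claim then only
    requires that minimal homogeneous generators exist
    ([syz_min_gens_exist]), which follows from Dickson's lemma.

    For the Betti numbers it remains to see that every minimal resolution of
    [J] is the image of one of [Jbar], for then the same ranks occur on both
    sides, without appeal to the uniqueness of minimal resolutions. The degree
    of a homogeneous minimal generator [g] of [N] is a multiple of [l]
    ([min_gens_mod]): otherwise [g = x^r w] with [r <> 0] and [w] in [N], and
    as [w] has smaller degree than [g], it is a combination of the other
    generators, so [g] is redundant. A homogeneous row whose degree is a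
    multiple of [l] lies in the image of [Phi], and [ppart 0] recovers its
    preimage; this descends a resolution of [J] one step at a time
    ([valid_choices_ppart]). *)

Set Implicit Arguments.
Unset Strict Implicit.
Unset Printing Implicit Defensive.

Import GRing.Theory.

(** * Ideals generated by a set *)

Section Ideals.
Local Open Scope ring_scope.
Variable R : comNzRingType.
Implicit Types (A : R -> Prop) (p q : R).

Lemma ideal_gen0 A : ideal_gen A 0.
Proof.
by exists 0%N, (fun=> 0), (fun=> 0); split=> [[]|]; rewrite ?big_ord0.
Qed.

Lemma ideal_genD A p q : ideal_gen A p -> ideal_gen A q -> ideal_gen A (p + q).
Proof.
move=> [k1 [c1 [g1 [Ag1 ->]]]] [k2 [c2 [g2 [Ag2 ->]]]].
pose glue (f1 : 'I_k1 -> R) (f2 : 'I_k2 -> R) i :=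
  match split i with inl j => f1 j | inr j => f2 j end.
exists (k1 + k2)%N, (glue c1 c2), (glue g1 g2); rewrite /glue.
split=> [i|]; first by case: splitP.
rewrite big_split_ord /=; congr (_ + _); apply: eq_bigr => i _.
  by rewrite -[lshift _ _]/(unsplit (inl i)) unsplitK.
by rewrite -[rshift _ _]/(unsplit (inr i)) unsplitK.
Qed.

Lemma ideal_genM A p q : ideal_gen A q -> ideal_gen A (p * q).
Proof.
move=> [k [c [g [Ag ->]]]]; exists k, (fun i => p * c i), g; split=> //.
by rewrite mulr_sumr; apply: eq_bigr => i _; rewrite mulrA.
Qed.

Lemma mem_ideal_gen A p : A p -> ideal_gen A p.
Proof.
move=> Ap; exists 1%N, (fun=> 1), (fun=> p); split=> //.
by rewrite big_ord1 mul1r.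
Qed.

Lemma ideal_gen_comb A (I : finType) (c g : I -> R) :
  (forall i, ideal_gen A (g i)) -> ideal_gen A (\sum_i c i * g i).
Proof.
move=> Ag; apply: big_ind => [||i _]; [exact: ideal_gen0|exact: ideal_genD|].
exact: ideal_genM.
Qed.

End Ideals.

(** * Linear maps given on monomials, and homogeneous components *)

Section MonomialMaps.
Local Open Scope ring_scope.
Variables (n : nat) (K : fieldType).
Local Notation P := {mpoly K[n]}.
Local Notation mon := 'X_{1..n}.

Definition monmap (f : mon -> P) (p : P) : P :=
  \sum_(m <- msupp p) p@_m *: f m.

(** The index set here does not depend on [p], whence the linearity of
    [monmap]. *)
Lemma monmapwE f k p : (msize p <= k)%N ->
  monmap f p = \sum_(m : 'X_{1..n < k}) p@_m *: f m.
Proof.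
move=> lt_pk; pose I : subFinType _ := 'X_{1..n < k}.
rewrite /monmap (big_mksub I) //=; first last.
  by move=> x /msize_mdeg_lt /leq_trans; apply.
  by rewrite msupp_uniq.
by rewrite big_rmcond //= => i; move/memN_msupp_eq0 ->; rewrite scale0r.
Qed.

Lemma monmap_is_linear f : linear (monmap f).
Proof.
move=> c p q; pose k := maxn (msize (c *: p + q)) (maxn (msize p) (msize q)).
rewrite !(@monmapwE f k) ?leq_max ?leqnn ?orbT // scaler_sumr -big_split /=.
by apply: eq_bigr => m _; rewrite mcoeffD mcoeffZ scalerDl scalerA.
Qed.

HB.instance Definition _ f := GRing.isLinear.Build K P P _ (monmap f)
  (monmap_is_linear f).

Lemma monmapX f m : monmap f 'X_[m] = f m.
Proof. by rewrite /monmap msuppX big_seq1 mcoeffX eqxx scale1r. Qed.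

(** Compared with induction on the terms of [p], the inductive step is exactly
    linearity, so that a linear identity reduces to the case of monomials. *)
Lemma mpoly_monind (Q : P -> Prop) :
  Q 0 -> (forall c p q, Q p -> Q q -> Q (c *: p + q)) ->
  (forall m, Q 'X_[m]) -> forall p, Q p.
Proof.
by move=> Q0 QD QX p; elim/mpolyind: p => // c m p _ _; apply: QD.
Qed.

(** The part of degree [d] of [p], when [p] multiplies a basis vector of degree
    [a]. Comparing [m + a] with [d], rather than [m] with a truncated difference
    [d - a], gives 0 when [a] does not divide [d]. *)
Definition hpart (d a : mon) : P -> P :=
  monmap (fun m => if (m + a)%MM == d then 'X_[m] else 0).

HB.instance Definition _ d a := GRing.Linear.on (hpart d a).

Definition hcomp t (a : 'I_t -> mon) (d : mon) (v : 'rV[P]_t) : 'rV[P]_t :=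
  \row_j hpart d (a j) (v ord0 j).

Lemma hpartX d a m :
  hpart d a 'X_[m] = if (m + a)%MM == d then 'X_[m] else 0.
Proof. exact: monmapX. Qed.

(** A coefficient of degree 0 is a constant; this is what makes a generator
    redundant when its coefficient has no constant term. *)
Lemma hpart_diag d (p : P) : hpart d d p = p@_0%MM *: 1.
Proof.
elim/mpoly_monind: p => [|c p q IHp IHq|m].
- by rewrite linear0 mcoeff0 scale0r.
- by rewrite linearP /= mcoeffD mcoeffZ IHp IHq scalerDl scalerA.
rewrite hpartX mcoeffX -[X in _ == X]add0m eqm_add2r.
by case: eqP => [->|_]; rewrite ?scale0r ?scale1r ?mpolyX0.
Qed.

Lemma hpart_id d a (p : P) :
  (forall m, m \in msupp p -> (m + a)%MM = d) -> hpart d a p = p.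
Proof.
move=> hp; rewrite [RHS]mpolyE /hpart /monmap.
by apply: eq_big_seq => m /hp ->; rewrite eqxx.
Qed.

Lemma msupp_hpart d a (p : P) m : m \in msupp (hpart d a p) -> (m + a)%MM = d.
Proof.
move=> /msupp_sum_le /flatten_mapP[m' _ /msuppZ_le].
case: eqP => [<- /mem_msuppXP -> //|_]; by rewrite msupp0.
Qed.

Lemma mhomog_hcomp t (a : 'I_t -> mon) d v : mhomog a (hcomp a d v) d.
Proof. by move=> j m; rewrite mxE; apply: msupp_hpart. Qed.

Lemma hcomp_id t (a : 'I_t -> mon) d v : mhomog a v d -> hcomp a d v = v.
Proof.
by move=> hv; apply/rowP=> j; rewrite mxE hpart_id // => m; apply: hv.
Qed.

Lemma hpartM d a b (p q : P) : (forall m, m \in msupp q -> (m + a)%MM = b) ->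
  hpart d a (p * q) = hpart d b p * q.
Proof.
move=> hq; rewrite [in LHS](mpolyE q) [q in RHS]mpolyE !mulr_sumr raddf_sum /=.
apply: eq_big_seq => m /hq mab; elim/mpoly_monind: p => [|c p1 p2 IH1 IH2|m1].
- by rewrite !(mul0r, linear0).
- by rewrite linearP /= !mulrDl linearD /= IH2 -!scalerAl linearZ /= IH1.
rewrite -!scalerAr linearZ /= -mpolyXD !hpartX -addmA mab.
by case: eqP; rewrite ?mul0r ?mpolyXD.
Qed.

(** A matrix with homogeneous rows is a map of degree 0 of graded modules, so
    it respects homogeneous components. Hence its kernel is a graded module, and
    the coefficients of a homogeneous combination can be taken homogeneous. *)
Lemma hcomp_mulmx s t (a : 'I_t -> mon) (b : 'I_s -> mon) (G : 'M[P]_(s, t)) d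
    (c : 'rV[P]_s) :
  (forall i, mhomog a (row i G) (b i)) ->
  hcomp a d (c *m G) = hcomp b d c *m G.
Proof.
move=> hG; apply/rowP=> j; rewrite !mxE raddf_sum /=; apply: eq_bigr => i _.
by rewrite mxE; apply: hpartM => m hm; apply: (hG i j m); rewrite mxE.
Qed.

End MonomialMaps.

(** * Discarding a redundant generator *)

Section Irredundance.
Local Open Scope ring_scope.

Lemma mulmx_row' (R : nzRingType) s t (c : 'rV[R]_s) (G : 'M[R]_(s, t)) i :
  c *m G = c ord0 i *: row i G + col' i c *m row' i G.
Proof.
apply/rowP=> j; rewrite !mxE (bigD1_ord i) //=; congr (_ + _).
by apply: eq_bigr => k _; rewrite !mxE.
Qed.

Lemma mulmx_row'1 (R : nzRingType) s t (c : 'rV[R]_s.-1) (G : 'M[R]_(s, t)) i :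
  c *m row' i G = (c *m row' i 1%:M) *m G.
Proof. by rewrite -mulmxA !row'Esub [in LHS]rowsubE. Qed.

Lemma generates_row' n (K : fieldType) s t (N : 'rV[{mpoly K[n]}]_t -> Prop)
    (G : 'M[{mpoly K[n]}]_(s, t)) i (e : 'rV[{mpoly K[n]}]_s) :
  generates N G -> e ord0 i = 0 -> row i G = e *m G -> generates N (row' i G).
Proof.
move=> gG ei Gi w; rewrite gG; split=> [[c ->]|[c ->]]; last first.
  by exists (c *m row' i 1%:M); apply: mulmx_row'1.
exists (c ord0 i *: col' i e + col' i c).
rewrite [LHS](mulmx_row' c G i) mulmxDl -scalemxAl; congr (_ *: _ + _).
by rewrite Gi (mulmx_row' e G i) ei scale0r add0r.
Qed.

End Irredundance.

(** * Freeness of the weighting map and extension of modules *)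

Section Weighting.
Local Open Scope ring_scope.
Variables (n : nat) (K : fieldType) (l : 'I_n -> nat).
Hypothesis l_gt0 : forall i, (0 < l i)%N.
Local Notation P := {mpoly K[n]}.
Local Notation mon := 'X_{1..n}.

Definition mnm_div (m : mon) : mon := [multinom (m i %/ l i)%N | i < n].
Definition mnm_mod (m : mon) : mon := [multinom (m i %% l i)%N | i < n].

Lemma Phi_degE m i : Phi_deg l m i = (l i * m i)%N.
Proof. exact: mnmE. Qed.

Lemma Phi_deg0 : Phi_deg l 0%MM = 0%MM.
Proof. by apply/mnmP=> i; rewrite Phi_degE !mnmE muln0. Qed.

Lemma Phi_degD m1 m2 :
  Phi_deg l (m1 + m2)%MM = (Phi_deg l m1 + Phi_deg l m2)%MM.
Proof. by apply/mnmP=> i; rewrite mnmDE !Phi_degE mnmDE mulnDr. Qed.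

Lemma mnm_div_PhiD m m' : mnm_div (Phi_deg l m + m')%MM = (m + mnm_div m')%MM.
Proof.
by apply/mnmP=> i; rewrite !(mnmDE, mnmE) mulnC divnMDl.
Qed.

Lemma mnm_mod_PhiD m m' : mnm_mod (Phi_deg l m + m')%MM = mnm_mod m'.
Proof. by apply/mnmP=> i; rewrite !(mnmDE, mnmE) mulnC modnMDl. Qed.

Lemma mnm_div0 : mnm_div 0%MM = 0%MM.
Proof. by apply/mnmP=> i; rewrite !mnmE div0n. Qed.

Lemma mnm_mod0 : mnm_mod 0%MM = 0%MM.
Proof. by apply/mnmP=> i; rewrite !mnmE mod0n. Qed.

Lemma mnm_div_Phi m : mnm_div (Phi_deg l m) = m.
Proof. by rewrite -[Phi_deg l m]addm0 mnm_div_PhiD mnm_div0 addm0. Qed.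

Lemma mnm_divmod m : m = (mnm_mod m + Phi_deg l (mnm_div m))%MM.
Proof.
by apply/mnmP=> i; rewrite mnmDE Phi_degE !mnmE addnC mulnC -divn_eq.
Qed.

Lemma Phi_deg_inj : injective (Phi_deg l).
Proof. exact: can_inj mnm_div_Phi. Qed.

HB.instance Definition _ :=
  GRing.RMorphism.copy (@Phi n K l) (comp_mpoly [tuple 'X_i ^+ l i | i < n]).
HB.instance Definition _ :=
  GRing.Linear.copy (@Phi n K l) (comp_mpoly [tuple 'X_i ^+ l i | i < n]).

Lemma PhiX m : Phi l 'X_[m] = 'X_[Phi_deg l m] :> P.
Proof.
rewrite /Phi comp_mpolyX [RHS]mpolyXE_id; apply: eq_bigr => i _.
by rewrite tnth_mktuple -exprM Phi_degE.
Qed.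

(** The coordinate of index [r] over [P] with respect to the basis of the [x^r];
    it is 0 when [r] is not a remainder modulo [l]. *)
Definition ppart (r : mon) : P -> P :=
  monmap (fun m => if mnm_mod m == r then 'X_[mnm_div m] else 0).

HB.instance Definition _ r := GRing.Linear.on (ppart r).

Lemma ppartX r m :
  ppart r 'X_[m] = if mnm_mod m == r then 'X_[mnm_div m] else 0.
Proof. exact: monmapX. Qed.

(** Linearity over [P], which acts on [S] through [Phi]. *)
Lemma ppart_PhiM r (p q : P) : ppart r (Phi l p * q) = p * ppart r q.
Proof.
elim/mpoly_monind: p => [|c p1 p2 IH1 IH2|m].
- by rewrite raddf0 !mul0r linear0.
- by rewrite linearP /= !mulrDl linearD /= IH2 -!scalerAl linearZ /= IH1.
elim/mpoly_monind: q => [|c q1 q2 IH1 IH2|m'].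
- by rewrite !(mulr0, linear0).
- by rewrite linearP /= !mulrDr linearD /= IH2 -!scalerAr linearZ /= IH1.
rewrite PhiX -mpolyXD !ppartX mnm_mod_PhiD mnm_div_PhiD.
by case: eqP; rewrite ?mulr0 ?mpolyXD.
Qed.

Lemma ppart_Phi r (p : P) : ppart r (Phi l p) = if r == 0%MM then p else 0.
Proof.
rewrite -[Phi l p]mulr1 ppart_PhiM -mpolyX0 ppartX mnm_mod0 mnm_div0 eq_sym.
by case: eqP; rewrite ?mulr0 // mpolyX0 mulr1.
Qed.

Lemma PhiK : cancel (@Phi n K l) (ppart 0%MM).
Proof. by move=> p; rewrite ppart_Phi eqxx. Qed.

(* A finite type containing all the remainders: their total degree is at most
   the sum of the weights. Its other elements have zero coordinates. *)
Local Notation residue := 'X_{1..n < (\sum_(i < n) l i).+1}.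

Lemma mnm_mod_lt m : (mdeg (mnm_mod m) < (\sum_(i < n) l i).+1)%N.
Proof.
by rewrite ltnS mdegE; apply: leq_sum => i _; rewrite mnmE ltnW // ltn_mod.
Qed.

Lemma ppart_sum (p : P) :
  p = \sum_(r : residue) 'X_[r] * Phi l (ppart r p).
Proof.
elim/mpoly_monind: p => [|c p1 p2 IH1 IH2|m].
- by rewrite big1 // => r _; rewrite !raddf0 mulr0.
- rewrite [in LHS]IH1 [in LHS]IH2 scaler_sumr -big_split /=.
  by apply: eq_bigr => r _; rewrite !linearP /= mulrDr scalerAr.
rewrite (bigD1 (BMultinom (mnm_mod_lt m))) //= big1 ?addr0 => [|r].
  by rewrite ppartX eqxx PhiX -mpolyXD -mnm_divmod.
by rewrite ppartX -val_eqE /= eq_sym => /negPf->; rewrite raddf0 mulr0.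
Qed.

Lemma ppart_mxM r s t u (c : 'M[P]_(u, s)) (A : 'M[P]_(s, t)) :
  map_mx (ppart r) (c *m Phi_mx l A) = map_mx (ppart r) c *m A.
Proof.
apply/matrixP=> i j; rewrite !mxE raddf_sum; apply: eq_bigr => k _ /=.
by rewrite !mxE mulrC ppart_PhiM mulrC.
Qed.

Lemma ppart_mx_sum s t (w : 'M[P]_(s, t)) :
  w = \sum_(r : residue) 'X_[r] *: Phi_mx l (map_mx (ppart r) w).
Proof.
apply/matrixP=> i j; rewrite summxE [LHS]ppart_sum.
by apply: eq_bigr => r _; rewrite !mxE.
Qed.

Lemma ppart_mx_eq0 s t (w : 'M[P]_(s, t)) :
  (forall r, map_mx (ppart r) w = 0) -> w = 0.
Proof.
move=> w0; rewrite [w]ppart_mx_sum big1 // => r _.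
by rewrite w0 /Phi_mx map_mx0 scaler0.
Qed.

Lemma Phi_mxK s t : cancel (@Phi_mx n K l s t) (map_mx (ppart 0%MM)).
Proof. by move=> A; apply/matrixP=> i j; rewrite !mxE PhiK. Qed.

(** As [S^t] is the direct sum of the [x^r Phi(P^t)], the submodule of [S^t]
    spanned by the image of a submodule [M] of [P^t] is the direct sum of the
    [x^r Phi(M)]; this is the condition below, with [N] for the span. *)
Definition extends t (M N : 'rV[P]_t -> Prop) :=
  forall w, N w <-> forall r, M (map_mx (ppart r) w).

(** Flatness of [Phi]: [ppart r] carries [w *m Phi A] to the product of the
    coordinate of [w] by [A]. *)
Lemma kernel_extends s t (A : 'M[P]_(s, t)) :
  extends (fun v => v *m A = 0) (fun w => w *m Phi_mx l A = 0).
Proof.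
move=> w; split=> [w0 r|w0]; first by rewrite -ppart_mxM w0 map_mx0.
by apply: ppart_mx_eq0 => r; rewrite ppart_mxM.
Qed.

(** Faithful flatness: [M] is recovered from its extension. *)
Lemma extends_Phi t (M N : 'rV[P]_t -> Prop) : extends M N -> M 0 ->
  forall v, N (Phi_mx l v) <-> M v.
Proof.
move=> eMN M0 v; rewrite eMN; split=> [/(_ 0%MM)|Mv r].
  by rewrite Phi_mxK.
have [->|/negPf r0] := eqVneq r 0%MM; first by rewrite Phi_mxK.
suff -> : map_mx (ppart r) (Phi_mx l v) = 0 by [].
by apply/matrixP=> i j; rewrite !mxE ppart_Phi r0.
Qed.

(** Coefficients over [S] restrict to coefficients over [P] by [ppart]. In the
    other direction, the coordinates of a row of [N] are combinations of [G],
    and these are put together by [ppart_mx_sum]. *)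
Lemma generates_extends s t (M N : 'rV[P]_t -> Prop) (G : 'M[P]_(s, t)) :
  extends M N -> generates N (Phi_mx l G) <-> generates M G.
Proof.
move=> eMN; split=> gG.
  have N0 : N 0 by apply/gG; exists 0; rewrite mul0mx.
  have M0 : M 0 by have := (eMN 0).1 N0 0%MM; rewrite map_mx0.
  move=> v; rewrite -(extends_Phi eMN M0) gG; split=> [][c cE].
    by exists (map_mx (ppart 0%MM) c); rewrite -ppart_mxM -cE Phi_mxK.
  by exists (Phi_mx l c); rewrite cE /Phi_mx map_mxM.
move=> w; rewrite eMN; split=> [Mw|[c ->] r]; last first.
  by rewrite ppart_mxM; apply/gG; exists (map_mx (ppart r) c).
have /fin_all_exists[c cE] : forall r : residue, exists c,
    map_mx (ppart r) w = c *m G by move=> r; apply/gG.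
exists (\sum_(r : residue) 'X_[r] *: Phi_mx l (c r)).
rewrite [LHS]ppart_mx_sum mulmx_suml; apply: eq_bigr => r _.
by rewrite cE /Phi_mx map_mxM scalemxAl.
Qed.

Lemma ideal_extends (I : P -> Prop) : monomial_ideal I ->
  extends (fun v : 'rV_1 => I (v ord0 ord0))
          (fun w : 'rV_1 => Phi_ideal l I (w ord0 ord0)).
Proof.
move=> [A IA] w; split=> [[k [c [g [gI wE]]]] r|Iw].
  have /fin_all_exists[p gE] i : exists p, I p /\ g i = Phi l p.
    by have [p] := gI i; exists p.
  rewrite mxE wE raddf_sum (eq_bigr (fun i => ppart r (c i) * p i)) => [|i _].
    by apply/IA/ideal_gen_comb => i; apply/IA; case: (gE i).
  by rewrite /= (gE i).2 mulrC ppart_PhiM mulrC.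
rewrite [w ord0 ord0]ppart_sum; apply: ideal_gen_comb => r.
apply: mem_ideal_gen; exists (ppart r (w ord0 ord0)) => //.
by have := Iw r; rewrite mxE.
Qed.

Lemma mcoeff_Phi (p : P) m : (Phi l p)@_(Phi_deg l m) = p@_m.
Proof.
elim/mpoly_monind: p => [|c p q IHp IHq|m1]; first by rewrite raddf0 !mcoeff0.
  by rewrite linearP /= !mcoeffD !mcoeffZ IHp IHq.
by rewrite PhiX !mcoeffX (inj_eq Phi_deg_inj).
Qed.

Lemma mem_msupp_Phi (p : P) m : m \in msupp (Phi l p) ->
  exists2 m', m' \in msupp p & m = Phi_deg l m'.
Proof.
rewrite {1}[p]mpolyE raddf_sum => /msupp_sum_le /flatten_mapP[m'].
rewrite filter_predT /= => pm'; rewrite linearZ /= PhiX => /msuppZ_le.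
by move/mem_msuppXP=> <-; exists m'.
Qed.

Lemma mhomog_Phi t (a : 'I_t -> mon) (v : 'rV[P]_t) d :
  mhomog (fun j => Phi_deg l (a j)) (Phi_mx l v) (Phi_deg l d) <-> mhomog a v d.
Proof.
split=> hv j m => [vm|].
  apply: Phi_deg_inj; rewrite Phi_degD; apply: hv.
  by rewrite mxE mcoeff_msupp mcoeff_Phi -mcoeff_msupp.
by rewrite mxE => /mem_msupp_Phi[m' /hv <- ->]; rewrite Phi_degD.
Qed.

Lemma min_gens_extends s t (M N : 'rV[P]_t -> Prop) a (G : 'M[P]_(s, t)) b :
  extends M N ->
  min_gens N (fun j => Phi_deg l (a j)) (Phi_mx l G) (fun i => Phi_deg l (b i))
    <-> min_gens M a G b.
Proof.
move=> eMN; split=> -[gG irG hG]; split.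
- exact/(generates_extends _ eMN).
- by move=> i /(generates_extends _ eMN); rewrite /Phi_mx map_row'; apply: irG.
- by move=> i; apply/mhomog_Phi; rewrite /Phi_mx map_row; apply: hG.
- exact/(generates_extends _ eMN).
- move=> i; rewrite /Phi_mx -map_row' => /(generates_extends _ eMN).
  exact: irG.
by move=> i; rewrite /Phi_mx -map_row; apply/mhomog_Phi.
Qed.

(** A polynomial whose monomials all have the same remainder [r] has only one
    nonzero coordinate. *)
Lemma ppart_eq r (p : P) : (forall m, m \in msupp p -> mnm_mod m = r) ->
  p = 'X_[r] * Phi l (ppart r p).
Proof.
move=> hp; rewrite {1}[p]mpolyE /ppart /monmap raddf_sum mulr_sumr /=.
apply: eq_big_seq => m /hp mr; rewrite mr eqxx linearZ /= PhiX -scalerAr.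
by rewrite -mpolyXD -mr -mnm_divmod.
Qed.

Lemma mhomog_mod t (a : 'I_t -> mon) (v : 'rV[P]_t) d :
  mhomog (fun j => Phi_deg l (a j)) v d ->
  v = 'X_[mnm_mod d] *: Phi_mx l (map_mx (ppart (mnm_mod d)) v).
Proof.
move=> hv; apply/rowP=> j; rewrite !mxE; apply: ppart_eq => m /hv <-.
by rewrite addmC mnm_mod_PhiD.
Qed.

Lemma mhomog_descend t (a : 'I_t -> mon) (v : 'rV[P]_t) d :
  mhomog (fun j => Phi_deg l (a j)) v d -> mnm_mod d = 0%MM ->
  v = Phi_mx l (map_mx (ppart 0%MM) v).
Proof. by move=> /mhomog_mod + d0; rewrite d0 mpolyX0 scale1r. Qed.

(** Let [r] be the remainder modulo [l] of the degree of a generator [g]. Then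
    [g = x^r w] with [w] in [N], hence [w = c *m G] and [g = (x^r c) *m G]. If
    [r <> 0], the homogeneous component of degree that of [g] gives a
    combination [e *m G = g] in which the coefficient of [g] is the constant
    term of a multiple of [x^r], that is 0: then [g] is redundant. *)
Lemma min_gens_mod s t (M N : 'rV[P]_t -> Prop) a (G : 'M[P]_(s, t)) b :
  extends M N -> min_gens N (fun j => Phi_deg l (a j)) G b ->
  forall i, mnm_mod (b i) = 0%MM.
Proof.
move=> eMN [gG irG hG] i; apply/eqP/contraT => r_neq0; exfalso.
apply: (irG i); set r := mnm_mod (b i) in r_neq0.
have N0 : N 0 by apply/gG; exists 0; rewrite mul0mx.
have M0 : M 0 by have := (eMN 0).1 N0 0%MM; rewrite map_mx0.
have NG : N (row i G) by apply/gG; exists (row i 1%:M); rewrite -row_mul mul1mx.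
have /gG[c cE] : N (Phi_mx l (map_mx (ppart r) (row i G))).
  by apply/(extends_Phi eMN M0)/((eMN _).1 NG).
pose e := hcomp b (b i) ('X_[r] *: c).
apply: (generates_row' (e := e) gG); last first.
  rewrite -[LHS](hcomp_id (hG i)) -(hcomp_mulmx _ _ hG); congr hcomp.
  by rewrite [LHS](mhomog_mod (hG i)) -scalemxAl -cE.
by rewrite !mxE hpart_diag rmorphM /= mcoeffX (negPf r_neq0) mul0r scale0r.
Qed.

End Weighting.

(** * Existence of minimal homogeneous generators *)

Section Existence.
Local Open Scope ring_scope.
Variables (n : nat) (K : fieldType).
Local Notation P := {mpoly K[n]}.
Local Notation mon := 'X_{1..n}.

(** Dickson's lemma for the order comparing the first [k] coordinates only. Let
    [s] be a finite set suited to the first [k] coordinates, and [N] the largest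
    [k]-th coordinate in [s]. An element of [A] with [k]-th coordinate at least
    [N] is above an element of [s]; the others have one of [N] possible values
    there, and for each of these the first [k] coordinates suffice. *)
Lemma dickson_upto (k : nat) (A : mon -> Prop) : exists s : seq mon,
  (forall m, m \in s -> A m) /\
  forall m, A m -> exists2 m', m' \in s &
    forall i : 'I_n, (i < k)%N -> (m' i <= m i)%N.
Proof.
elim: k A => [|k IH] A.
  have [[m Am]|noA] := classic (exists m, A m).
    exists [:: m]; split=> [m'|m' _]; first by rewrite mem_seq1 => /eqP->.
    by exists m; rewrite ?mem_head.
  by exists [::]; split=> // m Am; case: noA; exists m.
have [s [sA sP]] := IH A.
have [le_nk|lt_kn] := leqP n k.
  exists s; split=> // m /sP[m' sm' m'P]; exists m' => // i _.
  by apply: m'P; apply: leq_trans (ltn_ord i) le_nk.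
pose i0 := Ordinal lt_kn; pose N := (\max_(m <- s) m i0)%N.
have /fin_all_exists[u uP] (j : 'I_N) := IH (fun m => A m /\ m i0 = j).
exists (s ++ flatten [seq u j | j : 'I_N]); split=> [m|m Am].
  rewrite mem_cat => /orP[/sA//|/flatten_mapP[j _ ujm]].
  by case: ((uP j).1 m ujm).
have [le_Nm|lt_mN] := leqP N (m i0).
  have [m' sm' m'P] := sP m Am; exists m'; first by rewrite mem_cat sm'.
  move=> i; rewrite ltnS leq_eqVlt => /predU1P[ik|/m'P//].
  have -> : i = i0 by apply: val_inj.
  by apply: leq_trans le_Nm; apply: (leq_bigmax_seq (F := fun m : mon => m i0)).
have [m' um' m'P] := (uP (Ordinal lt_mN)).2 m (conj Am erefl).
exists m'.
  rewrite mem_cat; apply/orP; right; apply/flatten_mapP.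
  by exists (Ordinal lt_mN); rewrite ?mem_enum.
move=> i; rewrite ltnS leq_eqVlt => /predU1P[ik|/m'P//].
have -> : i = i0 by apply: val_inj.
by rewrite (((uP (Ordinal lt_mN)).1 m' um').2).
Qed.

Lemma dickson (A : mon -> Prop) : exists s : seq mon,
  (forall m, m \in s -> A m) /\
  forall m, A m -> exists2 m', m' \in s & (m' <= m)%MM.
Proof.
have [s [sA sP]] := dickson_upto n A; exists s; split=> // m /sP[m' sm' m'P].
by exists m' => //; apply/mnm_lepP=> i; apply: m'P.
Qed.

Lemma mpoly_monomial (p : P) m0 : (forall m, m \in msupp p -> m = m0) ->
  p = p@_m0 *: 'X_[m0].
Proof.
move=> hp; apply/mpolyP=> m; rewrite mcoeffZ mcoeffX.
have [<-|ne] := eqVneq m0 m; first by rewrite mulr1.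
rewrite mulr0; apply: memN_msupp_eq0; apply/negP=> /hp mE.
by rewrite mE eqxx in ne.
Qed.

(** The entries of homogeneous rows are scalar multiples of monomials, so they
    divide each other as soon as the degrees do. *)
Lemma mhomog_quotient t (a : 'I_t -> mon) (v w : 'rV[P]_t) d f j :
  mhomog a v d -> mhomog a w f -> (f <= d)%MM -> w ord0 j != 0 ->
  exists q : P, hpart d f q = q /\ v ord0 j = q * w ord0 j.
Proof.
move=> hv hw le_fd wj0; have [->|vj0] := eqVneq (v ord0 j) 0.
  by exists 0; rewrite mul0r linear0.
have ex_supp (p : P) : p != 0 -> exists m, m \in msupp p.
  by rewrite -msupp_eq0; case: (msupp p) => // m s _; exists m; apply: mem_head.
have [m0 m0v] := ex_supp _ vj0; have [m1 m1w] := ex_supp _ wj0.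
have m01 : m0 = (d - f + m1)%MM.
  apply: (@addIm _ (a j)); rewrite -addmA (hv _ _ m0v) (hw _ _ m1w).
  by rewrite submK.
have vE : v ord0 j = (v ord0 j)@_m0 *: 'X_[m0].
  by apply: mpoly_monomial => m /hv; rewrite -(hv _ _ m0v) => /addIm.
have wE : w ord0 j = (w ord0 j)@_m1 *: 'X_[m1].
  by apply: mpoly_monomial => m /hw; rewrite -(hw _ _ m1w) => /addIm.
exists (((v ord0 j)@_m0 / (w ord0 j)@_m1) *: 'X_[d - f]); split.
  by rewrite linearZ /= hpartX submK // eqxx.
rewrite [LHS]vE [in RHS]wE mcoeffZ mcoeffX eqxx mulr1.
rewrite -scalerAl -scalerAr scalerA -mpolyXD -m01 divfK //.
by rewrite -mcoeff_msupp.
Qed.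

Lemma mhomog_reduce t (a : 'I_t -> mon) (v w : 'rV[P]_t) d f q :
  mhomog a v d -> mhomog a w f -> hpart d f q = q -> mhomog a (v - q *: w) d.
Proof.
move=> hv hw hq; suff <- : hcomp a d (v - q *: w) = v - q *: w.
  exact: mhomog_hcomp.
apply/rowP=> j; rewrite !mxE linearB /= (hpartM _ _ (hw j)) hq.
by rewrite hpart_id // => m; apply: hv.
Qed.

(** Elimination of the last coordinate [j0] that may be nonzero: consider the
    degrees of the homogeneous rows of [M] with a nonzero entry at [j0]. By
    Dickson's lemma, each is above one of finitely many of them. Subtracting a
    multiple of a row of that degree cancels the entry at [j0] of a homogeneous
    row, and keeps the row in [M] and homogeneous. *)
Lemma homog_fg_upto t (a : 'I_t -> mon) (M : 'rV[P]_t -> Prop) (k : nat) :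
  (forall q v w, M v -> M w -> M (v - q *: w)) ->
  exists s (G : 'M[P]_(s, t)),
    (forall i, M (row i G) /\ exists d, mhomog a (row i G) d) /\
    forall v d, M v -> mhomog a v d ->
      (forall j : 'I_t, (k <= j)%N -> v ord0 j = 0) -> exists c, v = c *m G.
Proof.
move=> Mlin; elim: k => [|k [s [G [GM Gspan]]]].
  exists 0%N, 0; split=> [[]//|v d _ _ v0].
  by exists 0; rewrite mul0mx; apply/rowP=> j; rewrite v0 ?mxE.
have [le_tk|lt_kt] := leqP t k.
  exists s, G; split=> // v d Mv hv v0; apply: Gspan Mv hv _ => j le_kj.
  by have := leq_trans (ltn_ord j) le_tk; rewrite ltnNge le_kj.
pose j0 := Ordinal lt_kt.
pose lead d v := [/\ M v, mhomog a v d,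
  forall j : 'I_t, (k < j)%N -> v ord0 j = 0 & v ord0 j0 != 0].
have [F [FA FP]] := dickson (fun d => exists v, lead d v).
have /fin_all_exists[w wP] (i : 'I_(size F)) : exists w, lead (nth 0%MM F i) w.
  exact/FA/mem_nth.
exists (s + size F)%N, (col_mx G (\matrix_i w i)); split=> [i|v d Mv hv v0].
  rewrite -(splitK i); case: (split i) => i' /=.
    by rewrite rowKu; apply: GM.
  have [Mwi hwi _ _] := wP i'.
    by rewrite rowKd rowK; split=> //; exists (nth 0%MM F i').
have span0 u : M u -> mhomog a u d ->
    (forall j : 'I_t, (k < j)%N -> u ord0 j = 0) -> u ord0 j0 = 0 ->
    exists c, u = c *m G.
  move=> Mu hu u0 uj0; apply: Gspan Mu hu _ => j.
  rewrite leq_eqVlt => /predU1P[kj|/u0//].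
  by have -> : j = j0 by apply: val_inj.
have [vj0|vj0] := eqVneq (v ord0 j0) 0.
  have [c ->] := span0 v Mv hv v0 vj0.
  by exists (row_mx c 0); rewrite mul_row_col mul0mx addr0.
have [|f Ff le_fd] := FP d; first by exists v.
have lt_i : (index f F < size F)%N by rewrite index_mem.
pose i := Ordinal lt_i.
have [Mw] := wP i; rewrite nth_index // => hw w0 wj0.
have [q [hq vq]] := mhomog_quotient hv hw le_fd wj0.
have [|||| c cE] := span0 (v - q *: w i).
- exact: Mlin.
- exact: mhomog_reduce hw hq.
- by move=> j kj; rewrite !mxE v0 // w0 // mulr0 subrr.
- by rewrite !mxE -vq subrr.
exists (row_mx c (q *: delta_mx 0 i)).
by rewrite mul_row_col -cE -scalemxAl -rowE rowK subrK.
Qed.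

(** Redundant generators are removed one by one. The predicate [Q] on entries
    serves to keep the generators of a monomial ideal monomial. *)
Lemma min_gens_prune s t (M : 'rV[P]_t -> Prop) (a : 'I_t -> mon)
    (Q : P -> Prop) (G : 'M[P]_(s, t)) : generates M G ->
  (forall i, exists d, mhomog a (row i G) d) -> (forall i j, Q (G i j)) ->
  exists s' (G' : 'M[P]_(s', t)) b, min_gens M a G' b /\ forall i j, Q (G' i j).
Proof.
have [k] := ubnP s; elim: k s G => // k IH s G lt_sk gG hG QG.
have [[i giG]|irG] := classic (exists i, generates M (row' i G)).
  apply: (IH _ (row' i G)) => //.
  - by case: s i lt_sk {G gG hG QG giG} => [[]|].
  - move=> i'; have [d hd] := hG (lift i i'); exists d.
    by move=> j m; have := hd j m; rewrite !mxE.
  - by move=> i' j; rewrite mxE.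
have [b hb] := fin_all_exists hG.
exists s, G, b; split=> //; split=> // i giG.
by apply: irG; exists i.
Qed.

Lemma hpart_sum (D : seq mon) a (p : P) : uniq D ->
  (forall m, m \in msupp p -> (m + a)%MM \in D) ->
  \sum_(d <- D) hpart d a p = p.
Proof.
move=> uD pD; rewrite exchange_big /= [RHS]mpolyE.
apply: eq_big_seq => m /pD mD; rewrite (bigD1_seq _ mD uD) /= eqxx.
by rewrite big1 ?addr0 // => d; rewrite eq_sym => /negPf->; rewrite scaler0.
Qed.

(** A module stable under homogeneous components is spanned by its homogeneous
    elements, for which [homog_fg_upto] provides finitely many generators. *)
Lemma graded_min_gens t (a : 'I_t -> mon) (M : 'rV[P]_t -> Prop) :
  M 0 -> (forall q v w, M v -> M w -> M (v - q *: w)) ->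
  (forall d v, M v -> M (hcomp a d v)) ->
  exists s (G : 'M[P]_(s, t)) b, min_gens M a G b.
Proof.
move=> M0 Mlin Mhom.
have [s [G [GM Gspan]]] := homog_fg_upto a t Mlin.
have gG : generates M G.
  move=> v; split=> [Mv|[c ->]]; last first.
    rewrite mulmx_sum_row; apply: big_ind => // [u w Mu Mw|i _].
      by have := Mlin (-1) u w Mu Mw; rewrite scaleN1r opprK.
    by have := Mlin (- c ord0 i) 0 _ M0 (GM i).1; rewrite scaleNr sub0r opprK.
  pose D := undup (flatten
    [seq [seq (m + a j)%MM | m <- msupp (v ord0 j)] | j <- enum 'I_t]).
  have -> : v = \sum_(d <- D) hcomp a d v.
    apply/rowP=> j; rewrite summxE; under eq_bigr do rewrite mxE.
    rewrite hpart_sum ?undup_uniq // => m vm; rewrite mem_undup.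
    apply/flatten_mapP; exists j; first by rewrite mem_enum.
    exact: (map_f (fun m => (m + a j)%MM)).
  apply: (big_ind (fun u => exists c, u = c *m G)).
  - by exists 0; rewrite mul0mx.
  - move=> _ _ [c1 ->] [c2 ->].
    by exists (c1 + c2); rewrite mulmxDl.
  move=> d _; have /= := Gspan _ d (Mhom d v Mv) (mhomog_hcomp (v := v)).
  apply=> j; by rewrite leqNgt ltn_ord.
have [s' [G' [b [mG' _]]]] : exists s' (G' : 'M[P]_(s', t)) b,
    min_gens M a G' b /\ forall i j, (fun=> True) (G' i j).
  by apply: (min_gens_prune (Q := fun=> True) gG) => // i; case: (GM i).
by exists s', G', b.
Qed.

End Existence.

(** * Minimal generators of syzygy modules *)

Section Syzygies.
Local Open Scope ring_scope.
Variables (n : nat) (K : fieldType).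
Local Notation P := {mpoly K[n]}.
Local Notation mon := 'X_{1..n}.

(** The homogeneous generators given by [graded_min_gens] would only be scalar
    multiples of monomials; Dickson's lemma gives monomials directly. *)
Lemma monomial_ideal_min_gens (I : P -> Prop) (a : 'I_1 -> mon) :
  monomial_ideal I -> (forall j, a j = 0%MM) ->
  exists s (G : 'M[P]_(s, 1)) b,
    min_gens (fun v : 'rV_1 => I (v ord0 ord0)) a G b /\
    forall i j, exists m, G i j = 'X_[m].
Proof.
move=> [A IA] a0; have [F [FA FP]] := dickson A.
pose G := \matrix_(i < size F, j < 1) ('X_[nth 0%MM F i] : P).
apply: (min_gens_prune (Q := fun p => exists m, p = 'X_[m]) (G := G)).
- move=> v; rewrite IA; split=> [[k [c [g [gA vE]]]]|[c ->]]; last first.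
    rewrite mxE; apply: ideal_gen_comb => i; apply: mem_ideal_gen.
    by exists (nth 0%MM F i); rewrite ?mxE //; apply/FA/mem_nth.
  suff /fin_all_exists[e eE] i : exists e : 'rV[P]_(size F),
      forall j, (e *m G) ord0 j = g i.
    exists (\sum_i c i *: e i); rewrite mulmx_suml; apply/rowP=> j.
    rewrite ord1 vE summxE; apply: eq_bigr => i _.
    by rewrite -scalemxAl mxE eE.
  have [m Am ->] := gA i; have [f Ff le_fm] := FP m Am.
  have lt_f : (index f F < size F)%N by rewrite index_mem.
  exists ('X_[m - f] *: delta_mx 0 (Ordinal lt_f)) => j.
  by rewrite -scalemxAl -rowE !mxE /= nth_index // -mpolyXD submK.
- move=> i; exists (nth 0%MM F i) => j m; rewrite !mxE a0 addm0.
  by move/mem_msuppXP.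
by move=> i j; exists (nth 0%MM F i); rewrite mxE.
Qed.

Lemma syz_min_gens_exist (I : P -> Prop) (D : choices n K) k :
  monomial_ideal I -> valid_choices I D k ->
  exists s (G : 'M[P]_(s, rk D k)) b, syz_min_gens I G b.
Proof.
move=> monI [D0 vD]; case: k vD => [|k] vD.
  have [s [G [b [mG XG]]]] := monomial_ideal_min_gens monI D0.
  by exists s, G, b.
have [[_ _ hG] _] := vD k (leqnn _).
have [|||s [G [b mG]]] := @graded_min_gens n K (rk D k.+1) (@degs _ _ D k.+1)
    (@syz n K I D k.+1).
- exact: mul0mx.
- by move=> q v w /= v0 w0; rewrite mulmxBl v0 -scalemxAl w0 scaler0 subr0.
- move=> d v /= v0; rewrite -(hcomp_mulmx d v hG) v0.
  by apply/rowP=> j; rewrite !mxE linear0.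
by exists s, G, b.
Qed.

End Syzygies.

(** * Transfer of resolutions along the weighting map *)

Section Transfer.
Local Open Scope ring_scope.
Variables (n : nat) (K : fieldType) (l : 'I_n -> nat).
Hypothesis l_gt0 : forall i, (0 < l i)%N.
Variable I : {mpoly K[n]} -> Prop.
Hypothesis monI : monomial_ideal I.
Local Notation P := {mpoly K[n]}.
Local Notation mon := 'X_{1..n}.
Local Notation J := (Phi_ideal l I).

Lemma syz_Phi_extends (D : choices n K) k :
  extends l (@syz n K I D k) (@syz n K J (Phi_choices l D) k).
Proof. by case: k => [|k]; [apply: ideal_extends|apply: kernel_extends]. Qed.

Lemma syz_min_gens_Phi (D : choices n K) k s (G : 'M[P]_(s, rk D k)) b :
  syz_min_gens I G b ->
  @syz_min_gens _ _ J (Phi_choices l D) k s (Phi_mx l G)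
    (fun i => Phi_deg l (b i)).
Proof.
move=> [mG XG]; split.
  exact: (min_gens_extends l_gt0 _ G b (@syz_Phi_extends D k)).2 mG.
move=> k0 i j; have [m Gm] := XG k0 i j.
by exists (Phi_deg l m); rewrite mxE Gm PhiX.
Qed.

Lemma valid_choices_Phi (D : choices n K) k :
  valid_choices I D k -> valid_choices J (Phi_choices l D) k.
Proof.
move=> [D0 vD]; split=> [j|i /vD]; last exact: syz_min_gens_Phi.
by rewrite /= D0 Phi_deg0.
Qed.

(** The candidate preimage under [Phi_choices]. *)
Definition ppart_choices (D : choices n K) : choices n K :=
  @Choices n K (num_gens D) (fun k => map_mx (ppart l 0%MM) (gens D k))
    (fun k i => mnm_div l (@degs _ _ D k i)).

(** One step of the descent: once the degrees at level [k] are multiples of [l]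
    and the [k]-th syzygy module of [J] is an extension, the chosen generators
    have degrees multiple of [l], by [min_gens_mod], and come from [P]. *)
Lemma syz_min_gens_ppart (D : choices n K) k :
  extends l (@syz n K I (ppart_choices D) k) (@syz n K J D k) ->
  (forall j, mnm_mod l (@degs _ _ D k j) = 0%MM) ->
  syz_min_gens J (gens D k) (@degs _ _ D k.+1) ->
  [/\ syz_min_gens I (gens (ppart_choices D) k)
        (@degs _ _ (ppart_choices D) k.+1),
      gens D k = Phi_mx l (gens (ppart_choices D) k)
    & forall j, mnm_mod l (@degs _ _ D k.+1 j) = 0%MM].
Proof.
move=> eMN amod [mG XG].
have degE k' : (forall j, mnm_mod l (@degs _ _ D k' j) = 0%MM) ->
    @degs _ _ D k' = fun j => Phi_deg l (@degs _ _ (ppart_choices D) k' j).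
  move=> dmod; apply: functional_extensionality => j.
  by rewrite [LHS](mnm_divmod l) dmod add0m.
rewrite (degE k amod) in mG.
have bmod := min_gens_mod l_gt0 eMN mG.
have gE : gens D k = Phi_mx l (gens (ppart_choices D) k).
  case: mG => _ _ hG; apply/row_matrixP => i.
  by rewrite [LHS](mhomog_descend (hG i) (bmod i)) /Phi_mx -!map_row.
split=> //; split; last first.
  move=> k0 i j; have [m Gm] := XG k0 i j; exists (mnm_div l m).
  (* [ppart 0] carries the monomial [x^m] to a monomial or to 0; the latter is
     excluded because [x^m] is in the image of [Phi]. *)
  have PhiG : 'X_[m] = Phi l (ppart l 0%MM 'X_[m]) :> P.
    by rewrite -Gm [in LHS]gE !mxE.
  rewrite mxE Gm; move: PhiG; rewrite ppartX; case: ifP => // _.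
  by rewrite raddf0 => /(congr1 (mcoeff m)) /eqP;
    rewrite mcoeffX mcoeff0 eqxx oner_eq0.
rewrite gE (degE k.+1 bmod) in mG.
exact/(min_gens_extends l_gt0 _ _ _ eMN).
Qed.

Lemma valid_choices_ppart (D : choices n K) h :
  valid_choices J D h -> valid_choices I (ppart_choices D) h.
Proof.
move=> [D0 vD]; split=> [j|]; first by rewrite /= D0 mnm_div0.
have inv k : (k <= h)%N ->
    extends l (@syz n K I (ppart_choices D) k) (@syz n K J D k) /\
    forall j, mnm_mod l (@degs _ _ D k j) = 0%MM.
  elim: k => [_|k IH lt_kh].
    by split=> [|j]; [apply: ideal_extends|rewrite D0 mnm_mod0].
  have [eMN amod] := IH (ltnW lt_kh).
  have [_ gE bmod] := syz_min_gens_ppart eMN amod (vD k lt_kh).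
  split=> //; have := kernel_extends l_gt0 (gens (ppart_choices D) k).
  by rewrite -gE.
move=> k lt_kh; have [eMN amod] := inv k (ltnW lt_kh).
by have [] := syz_min_gens_ppart eMN amod (vD k lt_kh).
Qed.

End Transfer.

Theorem theorem5p2 (K : fieldType)
    (K_infinite : forall s : seq K, exists x : K, x \notin s)
    (n : nat) (n_ge2 : (2 <= n)%N)
    (l : 'I_n -> nat) (l_gt0 : forall i, (0 < l i)%N)
    (Jbar : {mpoly K[n]} -> Prop) (Jbar_monomial : monomial_ideal Jbar) :
  (forall (h : nat) (D : choices n K), (h <= n)%N ->
     valid_choices Jbar D h ->
     valid_choices (Phi_ideal l Jbar) (Phi_choices l D) h ->
     exists (sbar s : nat)
       (Gbar : 'M[{mpoly K[n]}]_(sbar, rk D h))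
       (G : 'M[{mpoly K[n]}]_(s, rk (Phi_choices l D) h))
       (bbar : 'I_sbar -> 'X_{1..n}) (b : 'I_s -> 'X_{1..n}),
       [/\ syz_min_gens Jbar Gbar bbar,
           syz_min_gens (Phi_ideal l Jbar) G b
         & bijects (fun v : 'rV[{mpoly K[n]}]_(rk D h) => Phi_mx l v)
             (row_set Gbar) (row_set G)]) /\
  (forall h : nat, total_betti Jbar h = total_betti (Phi_ideal l Jbar) h).
Proof.
split=> [h D _ vD _|h].
  have [s [G [b mG]]] := syz_min_gens_exist Jbar_monomial vD.
  exists s, s, G, (Phi_mx l G), b, (fun i => Phi_deg l (b i)).
  split=> //; first exact: syz_min_gens_Phi.
  split=> [_ [i ->]|v w _ _ /(can_inj (@Phi_mxK _ _ _ l_gt0 _ _)) //|_ [i ->]].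
    by exists i; rewrite /Phi_mx map_row.
  by exists (row i G); [exists i|rewrite /Phi_mx map_row].
(* Both Betti numbers are chosen by [epsilon] from equal sets of ranks. *)
rewrite /total_betti; congr epsilon; apply: functional_extensionality => b.
apply: propositional_extensionality; split=> [[D vD ->]|[D vD ->]].
  by exists (Phi_choices l D) => //; apply: valid_choices_Phi.
by exists (ppart_choices l D) => //; apply: valid_choices_ppart.
Qed.
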